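(* There exists a function $g:\mathbb{R}_+^2\to\mathbb{R}_+$, where $\mathbb{R}_+=[0,\infty)$, such that for any two independent $\mathbb{Z}$-valued random variables $X,X'$ with probability distributions $p_1,p_2$ of finite entropy, $$H(p_1\star p_2)-\frac{H(p_1)+H(p_2)}{2}\ \geq\ g(H(p_1),H(p_2)).$$ Moreover, $g$ is a non-negative and doubly-increasing function of its arguments, $\lim_{(c,d)\to(\infty,\infty)}g(c,d)=\frac{1}{8}\log_2(e)$, and $g(c,d)=0$ if and only if $c=d=0$.
   Context: For a probability distribution $p$ on $\mathbb{Z}$, $H(p)=-\sum_{i\in\mathbb{Z}}p(i)\log_2 p(i)$ is the Shannon entropy in bits (with $0\log_2 0=0$). $p\star q$ denotes convolution, $(p\star q)(i)=\sum_{j\in\mathbb{Z}}p(j)q(i-j)$; thus $H(p_1\star p_2)=H(X+X')$. A function $g:\mathbb{R}_+^2\to\mathbb{R}_+$ is doubly-increasing if for any value of one of the arguments it is an increasing function of the other argument, where ''increasing'' is meant in the monotone sense ($c\le c'$ implies $g(c,d)\le g(c',d)$, and similarly in the second argument). The function $g$ is universal: it does not depend on $p_1,p_2$. *)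

(* Defs.v *)
(* MathComp-Analysis *)
From HB Require Import structures.
From mathcomp Require Import all_boot all_order all_algebra.
From mathcomp Require Import all_classical all_reals all_analysis.

Set Implicit Arguments.
Unset Strict Implicit.
Unset Printing Implicit Defensive.

Import Order.TTheory GRing.Theory Num.Theory.
Import numFieldNormedType.Exports.

Local Open Scope classical_set_scope.
Local Open Scope ring_scope.

(* Z carries the discrete sigma-algebra, as the library does for nat, so that
   {RV P >-> int} is the type of Z-valued random variables. *)
HB.instance Definition _ := isPointed.Build int 0.

HB.instance Definition _ := @isMeasurable.Build default_measure_display
  int discrete_measurable discrete_measurable0
  discrete_measurableC discrete_measurableU.

Definition independent_RVs (d d1 d2 : measure_display) (T : measurableType d)
    (T1 : measurableType d1) (T2 : measurableType d2) (R : realType)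
    (P : probability T R) (X : {RV P >-> T1}) (Y : {RV P >-> T2}) : Prop :=
  forall (A : set T1) (B : set T2), measurable A -> measurable B ->
    P (X @^-1` A `&` Y @^-1` B) = (P (X @^-1` A) * P (Y @^-1` B))%E.

(* The law of X as a function i |-> P (X = i); the library's [pmf] is the same
   function, but restricted to real-valued random variables. *)
Definition int_pmf (d : measure_display) (T : measurableType d) (R : realType)
    (P : probability T R) (X : {RV P >-> int}) (i : int) : R :=
  fine (distribution P X [set i]).

Definition log2 (R : realType) (x : R) : R := ln x / ln 2.

(* When p is a probability mass function all the summands are nonnegative, so
   that the unordered sum [esum] is the usual (possibly infinite) value.  The
   convention 0 * log2 0 = 0 holds because [ln] is real-valued. *)
Definition shannon_entropy (R : realType) (p : int -> R) : \bar R :=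
  \esum_(i in [set: int]) (- (p i * log2 (p i)))%:E.

(* For probability mass functions the sum is at most 1, so [fine] does not
   discard an infinite value. *)
Definition convolution (R : realType) (p q : int -> R) (i : int) : R :=
  fine (\esum_(j in [set: int]) (p j * q (i - j))%:E).

(* A function on R_+^2 is represented by a function on R^2, of which only the
   values at nonnegative arguments matter. *)
Definition doubly_increasing (R : realType) (g : R -> R -> R) : Prop :=
  (forall c c' d, 0 <= c -> 0 <= d -> c <= c' -> g c d <= g c' d) /\
  (forall c d d', 0 <= c -> 0 <= d -> d <= d' -> g c d <= g c d').

(* Main.v *)
(* Write S = X + X' with law r.  In nats, twice the gap is the sum of the mutual
   informations I(X; S) + I(X'; S).  Two lower bounds, both obtained from Gibbs'
   inequality against a well-chosen joint law of (X, X'), cover all cases.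
   - If X has an atom of mass a, twice the gap is at least a H(X') - h(a), with h
     the binary entropy; likewise with X and X' exchanged.
   - If no atom exceeds th, choose m, n such that P(X <= m) and P(X' <= n) are
     within th / 2 of 1/2, and let A, B, s be the signs of membership in
     X <= m, X' <= n, S <= m + n, with t the mean of s.  Gibbs' inequality against
     the weights r(S) exp(k A (s - t) - K) gives I(X; S) >= k E[A (s - t)] - K as
     soon as these weights have mass at most 1, and similarly for X'.  Since
     s = A whenever A = B, one has (A + B)(s - t) = 1 + A B - (A + B) t, whose mean
     is at least (1 - th)^2.
   With k = 1/2, K = 1/8 (Hoeffding's lemma) and th -> 0, twice the gap is at
   least 1/4 - o(1), which is the constant of the theorem; small values of k
   give a positive bound for every th < 1.  The function g is then the infimum
   of the gaps over all pairs of laws of entropies at least c and d, capped by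
   the limit and by c + d. *)
Require Import Defs.
From mathcomp Require Import all_boot all_order all_algebra.
From mathcomp Require Import all_classical all_reals all_analysis.
From mathcomp Require Import zify ring lra.

Set Implicit Arguments.
Unset Strict Implicit.
Unset Printing Implicit Defensive.

Import Order.TTheory GRing.Theory Num.Theory.
Import numFieldNormedType.Exports.

Local Open Scope classical_set_scope.
Local Open Scope ring_scope.

(** * Sums of nonnegative families with a finite real value *)

Section HasSum.
Context {R : realType}.
Implicit Types (T : choiceType).

(** Bundling nonnegativity with a finite value lets later estimates add, scale and compare plain
    reals. *)
Definition has_sum T (f : T -> R) (A : R) : Prop :=
  (forall i, 0 <= f i) /\ \esum_(i in [set: T]) (f i)%:E = A%:E.

Lemma has_sum_ge0 T (f : T -> R) A : has_sum f A -> 0 <= A.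
Proof.
by move=> [f0 fA]; rewrite -lee_fin -fA; apply: esum_ge0 => i _; rewrite lee_fin.
Qed.

Lemma has_sum_unique T (f : T -> R) A B : has_sum f A -> has_sum f B -> A = B.
Proof. by move=> [_ fA] [_ fB]; apply: EFin_inj; rewrite -fA -fB. Qed.

Lemma eq_has_sum T (f g : T -> R) A : f =1 g -> has_sum f A -> has_sum g A.
Proof. by move=> /funext ->. Qed.

Lemma le_has_sum T (f g : T -> R) A B :
  has_sum f A -> has_sum g B -> (forall i, f i <= g i) -> A <= B.
Proof.
move=> [_ fA] [_ gB] fg; rewrite -lee_fin -fA -gB.
by apply: le_esum => i _; rewrite lee_fin.
Qed.

Lemma has_sum_dominated T (f g : T -> R) B :
  (forall i, 0 <= f i <= g i) -> has_sum g B -> exists A, has_sum f A.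
Proof.
move=> fg [_ gB]; exists (fine (\esum_(i in [set: T]) (f i)%:E)).
have f0 i : 0 <= f i by have /andP[] := fg i.
split=> //; rewrite fineK// ge0_fin_numE; last by apply: esum_ge0 => i _; rewrite lee_fin.
apply: (@le_lt_trans _ _ B%:E); last exact: ltry.
by rewrite -gB; apply: le_esum => i _; rewrite lee_fin; have /andP[] := fg i.
Qed.

Lemma has_sumD T (f g : T -> R) A B :
  has_sum f A -> has_sum g B -> has_sum (fun i => f i + g i) (A + B).
Proof.
move=> [f0 fA] [g0 gB]; split=> [i|]; first exact: addr_ge0.
by rewrite EFinD -fA -gB -esumD// => i _; rewrite lee_fin.
Qed.

Lemma has_sumB T (f g : T -> R) A B : (forall i, g i <= f i) ->
  has_sum f A -> has_sum g B -> has_sum (fun i => f i - g i) (A - B).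
Proof.
move=> gf fA gB.
have /has_sum_dominated/(_ fA)[C fgC] i : 0 <= f i - g i <= f i.
  by rewrite subr_ge0 gf/= gerBl (proj1 gB).
suff -> : A - B = C by [].
have := has_sumD fgC gB; rewrite (_ : (fun i => _) = f).
  by move=> /(has_sum_unique fA) ->; rewrite addrK.
by apply/funext => i; rewrite subrK.
Qed.

Lemma has_sum_cst0 T : has_sum (fun _ : T => 0) 0.
Proof. by split=> //; exact: esum1. Qed.

Lemma has_sumZ T (c : R) (f : T -> R) A : 0 <= c ->
  has_sum f A -> has_sum (fun i => c * f i) (c * A).
Proof.
rewrite le_eqVlt => /predU1P[<- _|c0 [f0 fA]].
  by rewrite mul0r; apply: eq_has_sum (has_sum_cst0 T) => i; rewrite mul0r.
split=> [i|]; first by rewrite mulr_ge0// ltW.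
rewrite EFinM -fA /esum -ereal_sup_pZl//; congr ereal_sup.
rewrite image_comp; apply: eq_imagel => X _ /=.
by rewrite ge0_mule_fsumr// => i; rewrite lee_fin.
Qed.

Lemma has_sum_single T (t : T) (c : R) : 0 <= c ->
  has_sum (fun i => if i == t then c else 0) c.
Proof.
move=> c0; split=> [i|]; first by case: ifP.
rewrite -[RHS](@esum_set1 R T t (fun=> c%:E))// [RHS]esum_mkcond.
by apply: eq_esum => i _; case: eqP => [->|it]; [rewrite mem_set|rewrite memNset].
Qed.

Lemma reindex_has_sum T T' (e : T -> T') (f : T' -> R) A :
  bijective e -> has_sum f A <-> has_sum (f \o e) A.
Proof.
move=> be; have [e' eK e'K] := be.
rewrite /has_sum (@reindex_esum R T T' setT setT e) ?setTT_bijective//.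
split=> -[f0 fA]; split=> // i; last by rewrite -[i]e'K; apply: f0.
exact: f0.
Qed.

Lemma has_sum_fst T T' (f : T -> T' -> R) (g : T -> R) A :
  (forall i, has_sum (f i) (g i)) -> has_sum g A ->
  has_sum (fun z => f z.1 z.2) A.
Proof.
move=> fg [g0 gA]; split=> [z|]; first exact: (proj1 (fg z.1)).
rewrite -gA (_ : [set: T * T'] = setT `*`` (fun=> setT)); last exact/seteqP.
rewrite -(@esum_esum R T T' setT (fun=> setT) (fun i j => (f i j)%:E)).
  by apply: eq_esum => i _; have [_ ->] := fg i.
by move=> i j _ _; rewrite lee_fin; exact: (proj1 (fg i)).
Qed.

Lemma has_sum_fst_inv T T' (f : T -> T' -> R) (g : T -> R) A :
  (forall i, has_sum (f i) (g i)) -> has_sum (fun z => f z.1 z.2) A ->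
  has_sum g A.
Proof.
move=> fg [_ fA]; split=> [i|]; first exact: has_sum_ge0 (fg i).
rewrite -fA (_ : [set: T * T'] = setT `*`` (fun=> setT)); last exact/seteqP.
rewrite -(@esum_esum R T T' setT (fun=> setT) (fun i j => (f i j)%:E)).
  by apply: eq_esum => i _; have [_ ->] := fg i.
by move=> i j _ _; rewrite lee_fin; exact: (proj1 (fg i)).
Qed.

Lemma has_sumM T T' (f : T -> R) (g : T' -> R) A B :
  has_sum f A -> has_sum g B -> has_sum (fun z => f z.1 * g z.2) (A * B).
Proof.
move=> fA gB; apply: (@has_sum_fst _ _ (fun i j => f i * g j) (fun i => f i * B)).
  by move=> i; apply: has_sumZ gB; exact: (proj1 fA).
rewrite mulrC; apply: eq_has_sum (has_sumZ (has_sum_ge0 gB) fA) => i.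
exact: mulrC.
Qed.

End HasSum.

(** * Convolution of probability mass functions *)

Section Convolution.
Context {R : realType}.
Implicit Types p q r : int -> R.

Lemma has_sum_le1 (T : choiceType) (p : T -> R) i : has_sum p 1 -> p i <= 1.
Proof.
move=> p1; have p0 := proj1 p1.
apply: (le_has_sum (has_sum_single i (p0 i)) p1) => j.
by case: eqP => [->|_]; rewrite ?lexx ?p0.
Qed.

Lemma convolution_has_sum p q i : has_sum p 1 -> has_sum q 1 ->
  has_sum (fun j => p j * q (i - j)) (convolution p q i).
Proof.
move=> p1 q1.
have [|A pqA] := @has_sum_dominated R int (fun j => p j * q (i - j)) p 1 _ p1.
  move=> j; rewrite mulr_ge0 ?(proj1 p1) ?(proj1 q1)//=.
  by rewrite ler_piMr ?(proj1 p1)// has_sum_le1.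
by rewrite /convolution (proj2 pqA).
Qed.

Lemma convolutionC p q : has_sum p 1 -> has_sum q 1 ->
  convolution p q = convolution q p.
Proof.
move=> p1 q1; apply/funext => i.
have bij_sub : bijective (fun j : int => i - j).
  by exists (fun j => i - j) => j; rewrite subKr.
have /(reindex_has_sum _ _ bij_sub) pq := convolution_has_sum i p1 q1.
apply: has_sum_unique pq (eq_has_sum _ (convolution_has_sum i q1 p1)) => j /=.
by rewrite subKr mulrC.
Qed.

(** Groups pairs of summands by their sum: (s, x) stands for the summands x and s - x. *)
Lemma bij_fibre_sum : bijective (fun z : int * int => (z.2, z.1 - z.2)).
Proof.
exists (fun z => (z.1 + z.2, z.1)) => -[x y] /=; last by rewrite (addrC x) addrK.
by rewrite (addrC y) subrK.
Qed.

Lemma convolution_has_sum1 p q :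
  has_sum p 1 -> has_sum q 1 -> has_sum (convolution p q) 1.
Proof.
move=> p1 q1; have := has_sumM p1 q1; rewrite mulr1.
move=> /(reindex_has_sum _ _ bij_fibre_sum) /=.
by apply: (@has_sum_fst_inv _ _ _ (fun s x => p x * q (s - x))) => s; exact: convolution_has_sum.
Qed.

Lemma has_sum_convolution p q (h : int -> R) A :
  has_sum p 1 -> has_sum q 1 -> (forall i, 0 <= h i) ->
  has_sum (fun s => convolution p q s * h s) A ->
  has_sum (fun z => p z.1 * q z.2 * h (z.1 + z.2)) A.
Proof.
move=> p1 q1 h0 rA; apply/(reindex_has_sum _ _ bij_fibre_sum) => /=.
apply: (@has_sum_fst _ _ _ (fun s x => p x * q (s - x) * h (x + (s - x)))) rA => s.
rewrite mulrC; apply: eq_has_sum (has_sumZ (h0 s) (convolution_has_sum s p1 q1)) => x.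
by rewrite mulrC [x + _]addrC subrK.
Qed.

(** With [bij_shift2], trades a pair of summands for one summand and the sum, where product weights
    such as p(x) r(s) have a known total. *)
Lemma bij_shift1 : bijective (fun z : int * int => (z.1, z.1 + z.2)).
Proof. by exists (fun z => (z.1, z.2 - z.1)) => -[x y] /=; rewrite (addrC x) ?addrK ?subrK. Qed.

Lemma bij_shift2 : bijective (fun z : int * int => (z.2, z.1 + z.2)).
Proof. by exists (fun z => (z.2 - z.1, z.1)) => -[x y] /=; rewrite ?addrK ?subrK. Qed.

Lemma le_convolution p q x y : has_sum p 1 -> has_sum q 1 ->
  p x * q y <= convolution p q (x + y).
Proof.
move=> p1 q1; have pq := convolution_has_sum (x + y) p1 q1.
have pq0 : 0 <= p x * q y by rewrite mulr_ge0 ?(proj1 p1) ?(proj1 q1).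
apply: (le_has_sum (has_sum_single x pq0) pq) => j.
by case: eqP => [->|_]; [rewrite addrAC subrr add0r|exact: (proj1 pq)].
Qed.

(** The tangent bound ln v <= v - 1 at v = w / u. Summed over a law u and weights w of total at most
    1, it is Gibbs' inequality. *)
Lemma gibbs (u w : R) : 0 <= u -> 0 <= w -> (0 < u -> 0 < w) ->
  u * (1 + ln w - ln u) <= w.
Proof.
move=> + w0; rewrite le_eqVlt => /predU1P[<- _|u0 /(_ u0) {}w0].
  by rewrite mul0r.
rewrite mulrC -ler_pdivlMr// -addrA -ln_div ?posrE//.
have := @le_ln1Dx _ (w / u - 1); rewrite [1 + _]addrC subrK => h.
by rewrite -lerBrDl h// ltrBrDl subrr divr_gt0.
Qed.

End Convolution.

(** * Lower bounds on the entropy of a sum *)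

Section EntropyOfSum.
Context {R : realType}.
Implicit Types p q r : int -> R.

(** [gibbs] for [b] against c exp E, multiplied by [a]. In use [a] and [b] are masses of the two
    summands and [c] that of their sum; a b <= c makes [c] positive where a b is. *)
Lemma gibbs_scaled (a b c E : R) : 0 <= a -> 0 <= b -> a * b <= c ->
  a * b * (1 + ln c + E - ln b) <= a * c * expR E.
Proof.
move=> a0 b0; have := a0; rewrite le_eqVlt => /predU1P[<- _|{}a0 abc].
  by rewrite !mul0r.
rewrite -!mulrA ler_pM2l//.
have c0 : 0 <= c by apply: le_trans abc; rewrite mulr_ge0// ltW.
have [->|b_neq0] := eqVneq b 0; first by rewrite mul0r mulr_ge0// expR_ge0.
have {}b0 : 0 < b by rewrite lt_neqAle eq_sym b_neq0.
have {}c0 : 0 < c by apply: lt_le_trans abc; rewrite mulr_gt0.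
have := @gibbs R b (c * expR E); rewrite lnM ?posrE ?expR_gt0// expRK => gb.
apply: le_trans (gb _ _ _); first by rewrite -!addrA.
- exact: ltW.
- by rewrite mulr_ge0 ?expR_ge0// ltW.
- by move=> _; rewrite mulr_gt0// expR_gt0.
Qed.

(** Turns the entropy of the sum into an expectation over the pair of summands, ready for termwise
    comparison. *)
Lemma has_sum_cross p q (h : R) : has_sum p 1 -> has_sum q 1 ->
  has_sum (fun s => - (convolution p q s * ln (convolution p q s))) h ->
  has_sum (fun z => p z.1 * q z.2 * - ln (convolution p q (z.1 + z.2))) h.
Proof.
move=> p1 q1 hr; apply: (has_sum_convolution (h := fun s => - ln (convolution p q s))) => //.
  move=> s; rewrite oppr_ge0 ln_le0// has_sum_le1//.
  exact: convolution_has_sum1.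
by apply: eq_has_sum hr => s; rewrite mulrN.
Qed.

(** Nonnegativity of I(X; S): Gibbs' inequality against p(x) r(x + y), under which X and S are
    independent. *)
Lemma entropy_convolution_ger p q (hq hr : R) :
  has_sum p 1 -> has_sum q 1 ->
  has_sum (fun i => - (q i * ln (q i))) hq ->
  has_sum (fun i => - (convolution p q i * ln (convolution p q i))) hr ->
  hq <= hr.
Proof.
move=> p1 q1 hhq hhr; set r := convolution p q.
have r1 : has_sum r 1 by exact: convolution_has_sum1.
have L := has_sumD (has_sumM p1 hhq) (has_sumM p1 q1).
have Rr := has_sumD (has_sum_cross p1 q1 hhr)
  (proj1 (reindex_has_sum _ _ bij_shift1) (has_sumM p1 r1)).
have := le_has_sum L Rr; rewrite !mul1r lerD2r; apply=> -[x y] /=.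
have := gibbs_scaled 0 (proj1 p1 x) (proj1 q1 y) (le_convolution x y p1 q1).
by rewrite -/r expR0; lra.
Qed.

Lemma entropy_convolution_gel p q (hp hr : R) :
  has_sum p 1 -> has_sum q 1 ->
  has_sum (fun i => - (p i * ln (p i))) hp ->
  has_sum (fun i => - (convolution p q i * ln (convolution p q i))) hr ->
  hp <= hr.
Proof.
move=> p1 q1 hhp; rewrite convolutionC// => hhr.
exact: entropy_convolution_ger hhp hhr.
Qed.

(* Gibbs' inequality against the law that draws, with probability [p x0],
   [x0] together with an independent copy of the sum, and otherwise the
   summand [y] together with an independent copy of the sum. *)
Lemma entropy_convolution_atom p q (hp hq hr : R) x0 :
  has_sum p 1 -> has_sum q 1 ->
  has_sum (fun i => - (p i * ln (p i))) hp ->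
  has_sum (fun i => - (q i * ln (q i))) hq ->
  has_sum (fun i => - (convolution p q i * ln (convolution p q i))) hr ->
  hp + p x0 * hq <=
    hr - p x0 * ln (p x0) - (1 - p x0) * ln (1 - p x0).
Proof.
move=> p1 q1 hhp hhq hhr; set r := convolution p q.
have r1 : has_sum r 1 by exact: convolution_has_sum1.
set a := p x0; have a0 : 0 <= a := proj1 p1 x0.
have a1 : a <= 1 := has_sum_le1 x0 p1.
pose d (x : int) : R := if x == x0 then 1 else 0.
pose p' (x : int) : R := if x == x0 then 0 else p x.
have d1 : has_sum d 1 by exact: has_sum_single.
have p'1 : has_sum p' (1 - a).
  apply: eq_has_sum (has_sumB _ p1 (has_sum_single x0 a0)) => x; rewrite /p'.
    by case: eqP => [->|_]; rewrite ?subrr ?subr0.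
  by case: eqP => [->|_] //; exact: (proj1 p1).
have la : 0 <= - ln a by rewrite oppr_ge0 ln_le0.
have la1 : 0 <= - ln (1 - a) by rewrite oppr_ge0 ln_le0// gerBl.
have L := has_sumD (has_sumD (has_sumM hhp q1) (has_sumM p1 hhq)) (has_sumM p1 q1).
have c0 : 0 <= 1 - a by rewrite subr_ge0.
have R1 := has_sumD
  (has_sumZ a0 (proj1 (reindex_has_sum _ _ bij_shift1) (has_sumM d1 r1)))
  (has_sumZ c0 (proj1 (reindex_has_sum _ _ bij_shift2) (has_sumM q1 r1))).
have R2 := has_sumD (has_sumD (has_sum_cross p1 q1 hhr)
   (has_sumZ la (has_sumZ a0 (has_sumM d1 q1))))
   (has_sumD (has_sumZ la1 (has_sumM p'1 q1)) (has_sumM p'1 hhq)).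
lapply (le_has_sum L (has_sumD R1 R2)); first by lra.
move=> [x y] /=; rewrite /d /p'.
have rs := le_convolution x y p1 q1; rewrite -/r in rs.
have p0 := proj1 p1 x; have q0 := proj1 q1 y.
have r0 := proj1 r1 (x + y).
(* At [x0] the first component of the mixture suffices and the second is dropped; elsewhere only the
   second is nonzero, and E = ln (1 - a) supplies its factor. *)
case: eqP => [xx0|/eqP xx0].
  rewrite xx0 -/a in rs r0 *.
  have := gibbs_scaled 0 a0 q0 rs; rewrite expR0.
  have : 0 <= (1 - a) * (q y * r (x0 + y)) by rewrite !mulr_ge0.
  lra.
have [p00|px] := eqVneq (p x) 0.
  by rewrite p00 !(mul0r, mulr0, oppr0, addr0, add0r) mulr_ge0// mulr_ge0.
have c1 : 0 < 1 - a.
  apply: (@lt_le_trans _ _ (p x)); first by rewrite lt_neqAle eq_sym px p0.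
  by have := le_has_sum (has_sum_single x p0) p'1; apply=> z;
    case: eqP => [->|_]; rewrite ?(proj1 p'1)// /p' (negbTE xx0).
rewrite mulrC in rs.
have := gibbs_scaled (ln (1 - a)) q0 p0 rs; rewrite lnK ?posrE//.
lra.
Qed.

End EntropyOfSum.

(** * The inequality obtained by cutting both laws in two *)

Section CutInequality.
Context {R : realType}.
Implicit Types p q r : int -> R.

Definition lower_mass p (m : int) (A : R) : Prop :=
  has_sum (fun x => if x <= m then p x else 0) A.

Lemma lower_mass_bound p m A : has_sum p 1 -> lower_mass p m A -> 0 <= A <= 1.
Proof.
move=> p1 pA; rewrite (has_sum_ge0 pA)/=; apply: (le_has_sum pA p1) => x.
by case: ifP; rewrite ?lexx ?(proj1 p1).
Qed.

Lemma has_sum_cut p m A c c' : has_sum p 1 -> lower_mass p m A ->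
  0 <= c -> 0 <= c' ->
  has_sum (fun x => p x * if x <= m then c else c') (A * c + (1 - A) * c').
Proof.
move=> p1 pA c0 c'0.
have pA' : has_sum (fun x => p x - if x <= m then p x else 0) (1 - A).
  by apply: (has_sumB _ p1 pA) => x; case: ifP; rewrite ?lexx ?(proj1 p1).
have := has_sumD (has_sumZ c0 pA) (has_sumZ c'0 pA').
rewrite mulrC [c' * _]mulrC; apply: eq_has_sum => x.
by case: ifP; rewrite ?subrr ?subr0 !(mulr0, addr0, add0r) mulrC.
Qed.

Lemma has_sum_cut2 p r m n A B c11 c12 c21 c22 :
  has_sum p 1 -> has_sum r 1 -> lower_mass p m A -> lower_mass r n B ->
  0 <= c11 -> 0 <= c12 -> 0 <= c21 -> 0 <= c22 ->
  has_sum (fun z => p z.1 * r z.2 * if z.1 <= m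
      then if z.2 <= n then c11 else c12 else if z.2 <= n then c21 else c22)
    (A * (B * c11 + (1 - B) * c12) + (1 - A) * (B * c21 + (1 - B) * c22)).
Proof.
move=> p1 r1 pA rB c11_ge0 c12_ge0 c21_ge0 c22_ge0.
have /andP[B0 B1] := lower_mass_bound r1 rB.
apply: (@has_sum_fst _ _ _
  (fun x s => p x * r s * if x <= m
     then if s <= n then c11 else c12 else if s <= n then c21 else c22)
  (fun x => p x * if x <= m
     then B * c11 + (1 - B) * c12 else B * c21 + (1 - B) * c22)); last first.
  by apply: has_sum_cut => //; rewrite addr_ge0// mulr_ge0// subr_ge0.
move=> x; case: ifP => _ /=.
  by apply: eq_has_sum (has_sumZ (proj1 p1 x) (has_sum_cut r1 rB c11_ge0 c12_ge0)) => s /=;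
    rewrite mulrA.
by apply: eq_has_sum (has_sumZ (proj1 p1 x) (has_sum_cut r1 rB c21_ge0 c22_ge0)) => s /=;
  rewrite mulrA.
Qed.

(* The bound [exp K] on the moment generating function at [2 k] of a centred
   Bernoulli variable of any parameter [t]. *)
Definition bernoulli_mgf_le (k K : R) : Prop := forall t, 0 <= t <= 1 ->
  t * expR (2 * k * (1 - t) - K) + (1 - t) * expR (- (2 * k * t) - K) <= 1.

(** Here [A], [B], [C] are the masses below the cuts, so the sign s of the sum has mean t = 2 C - 1.
    The Gibbs bounds for the two summands are added termwise. *)
Lemma entropy_convolution_cut p q (hp hq hr : R) m n A B C k K :
  has_sum p 1 -> has_sum q 1 ->
  has_sum (fun i => - (p i * ln (p i))) hp ->
  has_sum (fun i => - (q i * ln (q i))) hq ->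
  has_sum (fun i => - (convolution p q i * ln (convolution p q i))) hr ->
  lower_mass p m A -> lower_mass q n B ->
  lower_mass (convolution p q) (m + n) C ->
  0 <= k -> 0 <= K -> bernoulli_mgf_le k K ->
  4 * k * (A * B * (1 - C) + (1 - A) * (1 - B) * C) - 2 * K <=
    2 * hr - hp - hq.
Proof.
move=> p1 q1 hhp hhq hhr pA qB; set r := convolution p q => rC k0 K0 mgf.
have r1 : has_sum r 1 by exact: convolution_has_sum1.
have /andP[A0 A1] := lower_mass_bound p1 pA.
have /andP[B0 B1] := lower_mass_bound q1 qB.
have /andP[C0 C1] := lower_mass_bound r1 rC.
(* The exponents k a (s - t) - K for the signs a of a summand and s of the sum, in the order ++, +-,
   -+, --. *)
pose e11 := 2 * k * (1 - C) - K; pose e12 := - (2 * k * C) - K.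
pose e21 := - (2 * k * (1 - C)) - K; pose e22 := 2 * k * C - K.
have e1 : C * expR e11 + (1 - C) * expR e12 <= 1 by apply: mgf; rewrite C0.
have e2 : C * expR e21 + (1 - C) * expR e22 <= 1.
  have := mgf (1 - C); rewrite !subKr subr_ge0 gerBl C0 C1 => /(_ isT) h.
  by rewrite addrC; apply: le_trans h; rewrite le_eqVlt eqxx.
have mix x : 0 <= x -> x <= 1 -> x * (C * expR e11 + (1 - C) * expR e12) +
    (1 - x) * (C * expR e21 + (1 - C) * expR e22) <= 1.
  move=> x0 x1; have := ler_wpM2l x0 e1.
  have x1' : 0 <= 1 - x by rewrite subr_ge0.
  have := ler_wpM2l x1' e2; lra.
have W1 := has_sum_cut2 p1 r1 pA rC
  (expR_ge0 e11) (expR_ge0 e12) (expR_ge0 e21) (expR_ge0 e22).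
have W2 := has_sum_cut2 q1 r1 qB rC
  (expR_ge0 e11) (expR_ge0 e12) (expR_ge0 e21) (expR_ge0 e22).
(* The mean of k (a + b) (s - t): zero where the signs a and b differ, while s equals them where
   they agree. *)
have V : has_sum (fun z => p z.1 * q z.2 * if z.1 <= m
      then if z.2 <= n then 4 * k * (1 - C) else 0 else if z.2 <= n then 0 else 4 * k * C)
    (A * (B * (4 * k * (1 - C)) + (1 - B) * 0) +
     (1 - A) * (B * 0 + (1 - B) * (4 * k * C))).
  by apply: has_sum_cut2 => //; rewrite !mulr_ge0// subr_ge0.
have L := has_sumD (has_sumD (has_sumD (has_sumM hhp q1) (has_sumM p1 hhq))
  (has_sumZ (ler0n R 2) (has_sumM p1 q1))) V.
have Rr := has_sumD
  (has_sumD (has_sumZ (ler0n R 2) (has_sum_cross p1 q1 hhr))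
     (has_sumZ (mulr_ge0 (ler0n R 2) K0) (has_sumM p1 q1)))
  (has_sumD (proj1 (reindex_has_sum _ _ bij_shift1) W1)
     (proj1 (reindex_has_sum _ _ bij_shift2) W2)).
have := mix A A0 A1; have := mix B B0 B1.
lapply (le_has_sum L Rr); first by lra.
move=> [x y] /=.
have rs := le_convolution x y p1 q1; rewrite -/r in rs.
have p0 := proj1 p1 x; have q0 := proj1 q1 y.
have := gibbs_scaled (if x <= m then if x + y <= m + n then e11 else e12
  else if x + y <= m + n then e21 else e22) p0 q0 rs.
rewrite mulrC in rs.
have := gibbs_scaled (if y <= n then if x + y <= m + n then e11 else e12
  else if x + y <= m + n then e21 else e22) q0 p0 rs.
rewrite /e11 /e12 /e21 /e22.
(* Summands on the same side of their cuts put the sum on that side, which excludes two of the eight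
   cases. *)
case: (leP x m) => xm; case: (leP y n) => yn; case: (leP (x + y) (m + n)) => xyn.
- lra.
- by have := lerD xm yn; rewrite leNgt xyn.
- lra.
- lra.
- lra.
- lra.
- by have := ltrD xm yn; rewrite ltNge xyn.
- lra.
Qed.

End CutInequality.

(** * Moment generating function of a centred Bernoulli variable *)

Section BernoulliMgf.
Context {R : realType}.

(** exp (-u) >= 1 - u gives exp u <= 1 / (1 - u), and (1 + u + 2 u^2) (1 - u) = 1 + u^2 (1 - 2 u) >=
    1. *)
Lemma expR_le_quadratic (u : R) : u <= 2^-1 -> expR u <= 1 + u + 2 * u ^+ 2.
Proof.
move=> u_le; have u1 : 0 < 1 - u by lra.
have : expR u * (1 - u) <= 1.
  have := expR_ge1Dx (- u); rewrite -(ler_pM2l (expR_gt0 u)) expRN divff//.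
  by rewrite gt_eqF// expR_gt0.
have : 1 <= (1 + u + 2 * u ^+ 2) * (1 - u) by nra.
by move=> h1 h2; rewrite -(ler_pM2r u1) (le_trans h2).
Qed.

(** In the quadratic bounds the linear terms cancel, leaving 8 k^2 t (1 - t) <= 2 k^2, and 1 + K <=
    exp K. As this K is of order k^2, a gain linear in k wins for small k. *)
Lemma bernoulli_mgf_le_small (k : R) : 0 <= k <= 4^-1 ->
  bernoulli_mgf_le k (2 * k ^+ 2).
Proof.
move=> /andP[k0 k1] t /andP[t0 t1].
rewrite !expRB !mulrA -mulrDl ler_pdivrMr ?expR_gt0// mul1r.
apply: le_trans (expR_ge1Dx _).
have h1 : expR (2 * k * (1 - t)) <= 1 + 2 * k * (1 - t) + 2 * (2 * k * (1 - t)) ^+ 2.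
  by apply: expR_le_quadratic; nra.
have h2 : expR (- (2 * k * t)) <= 1 - 2 * k * t + 2 * (- (2 * k * t)) ^+ 2.
  by apply: expR_le_quadratic; nra.
have : t * expR (2 * k * (1 - t)) <=
    t * (1 + 2 * k * (1 - t) + 2 * (2 * k * (1 - t)) ^+ 2) by rewrite ler_wpM2l.
have : (1 - t) * expR (- (2 * k * t)) <=
    (1 - t) * (1 - 2 * k * t + 2 * (- (2 * k * t)) ^+ 2) by rewrite ler_wpM2l// subr_ge0.
have : 8 * k ^+ 2 * (t * (1 - t)) <= 2 * k ^+ 2.
  by have := sqr_ge0 (1 - 2 * t); have := sqr_ge0 k; nra.
lra.
Qed.

(** exp (1/2) is the 128th power of exp (1/256), at which 1 + u <= exp u <= 1 / (1 - u) is sharp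
    enough. *)
Lemma expR_half_bounds : 28 / 17 <= expR (2^-1 : R) <= 71 / 43.
Proof.
have e : expR (2^-1 : R) = expR (256^-1) ^+ 128.
  by rewrite -expRM_natr; congr expR; lra.
have l : 257 / 256 <= expR (256^-1 : R).
  by apply: le_trans (expR_ge1Dx _); lra.
have u : expR (256^-1 : R) <= 256 / 255.
  have := expR_ge1Dx (- 256^-1 : R); rewrite expRN.
  rewrite -(ler_pM2r (expR_gt0 (256^-1 : R))) mulVf ?gt_eqF ?expR_gt0// => h.
  by have := expR_gt0 (256^-1 : R); lra.
have pow (a b : R) : 0 <= a -> a <= b -> a ^+ 128 <= b ^+ 128.
  by move=> a0 ab; rewrite lerXn2r ?nnegrE// (le_trans a0).
rewrite e; apply/andP; split.
  by apply: le_trans (pow _ _ _ l); clear; lra.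
by apply: le_trans (pow _ _ _ u) _; [exact: expR_ge0|clear; lra].
Qed.

Lemma le_expR_sub1 (x : R) : x <= expR (x - 1).
Proof. by have := expR_ge1Dx (x - 1); rewrite addrCA subrr addr0. Qed.

(* With [z := y - y^-1], the slope in [t] of the left-hand side, the latter is a
   product [s * z]; the tangent bound [x <= exp (x - 1)] at [s] and at [z] loses
   little enough because [y] is close to [exp (1/2)]. *)
Lemma le_expR_chord (y t : R) : 28 / 17 <= y <= 71 / 43 -> 0 <= t ->
  t * y + (1 - t) / y <= expR (t - 3 / 8).
Proof.
move=> /andP[yl yu] t0.
have y_gt0 : 0 < y by lra.
have y2 : 0 < y ^+ 2 - 1 by nra.
have -> : t * y + (1 - t) / y = (t + (y ^+ 2 - 1)^-1) * (y - y^-1).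
  by field; rewrite !gt_eqF.
have z0 : 0 <= y - y^-1 by rewrite subr_ge0 -div1r ler_pdivrMr//; nra.
(* The exponents of the two tangent bounds add up to [t] plus this quantity minus 2, and 13/8 - 2 =
   -3/8. *)
have bound : (y ^+ 2 - 1)^-1 + (y - y^-1) <= 13 / 8.
  have -> : (y ^+ 2 - 1)^-1 + (y - y^-1) = (y + (y ^+ 2 - 1) ^+ 2) / (y * (y ^+ 2 - 1)).
    by field; rewrite !gt_eqF.
  rewrite ler_pdivrMr ?mulr_gt0//.
  have : 0 <= (y - 28 / 17) * (71 / 43 - y) by rewrite mulr_ge0 ?subr_ge0.
  nra.
apply: (@le_trans _ _ (expR (t + (y ^+ 2 - 1)^-1 - 1) * expR (y - y^-1 - 1))).
  by rewrite ler_pM ?le_expR_sub1// addr_ge0// invr_ge0 ltW.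
by rewrite -expRD ler_expR; lra.
Qed.

(** Factoring out exp (3/8 - t) leaves [le_expR_chord] at y = exp (1/2). *)
Lemma bernoulli_mgf_le_half : bernoulli_mgf_le (2^-1 : R) 8^-1.
Proof.
move=> t /andP[t0 t1].
have -> : 2 * 2^-1 * (1 - t) - 8^-1 = 2^-1 - (t - 3 / 8) :> R by lra.
have -> : - (2 * 2^-1 * t) - 8^-1 = - 2^-1 - (t - 3 / 8) :> R by lra.
rewrite (expRB 2^-1) (expRB (- 2^-1)) expRN !mulrA -mulrDl.
rewrite ler_pdivrMr ?expR_gt0// mul1r.
exact: le_expR_chord expR_half_bounds t0.
Qed.

End BernoulliMgf.

(** * Laws of integer-valued variables and balanced cuts *)

Section IntPmf.
Context {R : realType}.

(** Countable additivity along the enumeration by [pickle]; codes of no integer are given the empty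
    set. *)
Lemma esum_measure_set1 (mu : {measure set int -> \bar R}) :
  \esum_(i in [set: int]) mu [set i] = mu [set: int].
Proof.
pose F n : set int := if pickle_inv n is Some x then [set x] else set0.
have FE x : F (pickle x) = [set x] by rewrite /F pickleK_inv.
have FT : \bigcup_n F n = [set: int].
  by apply/seteqP; split=> // x _; exists (pickle x) => //; rewrite FE.
rewrite -[in RHS]FT measure_bigcup//=; last first.
  apply/trivIsetP => i j _ _ ij; rewrite /F.
  case Ei : (pickle_inv i) => [x|]; last by rewrite set0I.
  case Ej : (pickle_inv j) => [y|]; last by rewrite setI0.
  rewrite -subset0 => z [/= zx zy].
  have := @pickle_invK int i; have := @pickle_invK int j; rewrite /ocancel Ei Ej /= -zx -zy.
  by move=> zj zi; rewrite -zi -zj eqxx in ij.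
rewrite nneseries_esum// (_ : [set n | n \in setT] = setT); last first.
  by apply/seteqP; split=> // n _ /=; rewrite inE.
transitivity (\esum_(n in pickle @` [set: int]) mu (F n)).
  rewrite esum_image; last by move=> x y _ _; exact: (pcan_inj pickleK_inv).
  by apply: eq_esum => x _; rewrite FE.
rewrite esum_mkcond; apply: eq_esum => n _; case: ifPn => // nF.
rewrite /F; case E : (pickle_inv n) => [x|]; last by rewrite measure0.
have := @pickle_invK int n; rewrite /ocancel E /= => xn.
by move: nF; rewrite notin_setE => -[]; exists x.
Qed.

Lemma int_pmf_has_sum1 d (T : measurableType d) (P : probability T R)
  (X : {RV P >-> int}) : has_sum (int_pmf X) 1.
Proof.
split=> [i|]; first by rewrite /int_pmf fine_ge0.
rewrite -(@probability_setT _ _ _ (distribution P X)) -esum_measure_set1.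
by apply: eq_esum => i _; rewrite /int_pmf fineK// fin_num_measure.
Qed.

(** At the first m where the distribution function F reaches 1/2, it jumps by at most [th], so F m
    or F (m - 1) is within th / 2 of 1/2. *)
Lemma balanced_cut (p : int -> R) th : has_sum p 1 -> (forall x, p x <= th) ->
  exists m A, lower_mass p m A /\ (1 - th) / 2 <= A <= (1 + th) / 2.
Proof.
move=> p1 pth; have p0 := proj1 p1.
have th0 : 0 <= th := le_trans (p0 0) (pth 0).
have /choice[F FE] m : exists A, lower_mass p m A.
  by apply: has_sum_dominated p1 => x; case: ifP; rewrite ?lexx p0.
(* A finite set holding more than half of the mass, contained in [-N, N], yields F N >= 1/2 and F
   (-N - 1) < 1/2 without limits at infinity. *)
have [X [X_fin _] X_half] : exists2 X, fsets [set: int] X &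
    ((2^-1 : R)%:E < \sum_(i \in X) (p i)%:E)%E.
  have : ((2^-1 : R)%:E < \esum_(i in [set: int]) (p i)%:E)%E.
    by rewrite (proj2 p1) lte_fin; lra.
  by move=> /ereal_sup_gt[_ [X ? <-] ?]; exists X.
have [c pXc] : exists c, has_sum (fun x => if x \in X then p x else 0) c.
  by apply: has_sum_dominated p1 => x; case: ifP; rewrite ?lexx p0.
have c_half : 2^-1 < c.
  rewrite -lte_fin -(proj2 pXc); apply: (lt_le_trans X_half).
  rewrite -esum_fset//; last by move=> i _; rewrite lee_fin.
  rewrite esum_mkcond; apply: le_esum => x _.
  by case: ifP.
have [s Xs] := proj1 (finite_seqP X) X_fin.
pose N := (\max_(x <- s) `|x|)%N.
have XN x : x \in X -> - N%:Z <= x <= N%:Z.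
  rewrite Xs inE /= => xs; rewrite -ler_norml -abszE lez_nat.
  exact: (leq_bigmax_seq (F := fun x : int => `|x|%N) _ xs).
have FN : 2^-1 <= F N%:Z.
  apply: (le_trans (ltW c_half)); apply: (le_has_sum pXc (FE _)) => x.
  case: ifPn => [/XN/andP[_ ->]//|_]; by case: ifP.
have F0 : F (- N%:Z - 1) < 2^-1.
  suff : F (- N%:Z - 1) + c <= 1 by lra.
  apply: (le_has_sum (has_sumD (FE _) pXc) p1) => x.
  case: ifPn => xN; case: ifPn => xX; rewrite ?addr0 ?add0r//.
  by have := XN _ xX; lia.
have [k kP kmin] : exists2 k, 2^-1 <= F (- N%:Z - 1 + k%:Z) &
    forall j, 2^-1 <= F (- N%:Z - 1 + j%:Z) -> (k <= j)%N.
  have : exists k : nat, 2^-1 <= F (- N%:Z - 1 + k%:Z).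
    exists (N + N + 1)%N; rewrite (_ : - _ - 1 + _ = N%:Z)//; lia.
  by move=> /[dup] ex _; exists (ex_minn ex); case: ex_minnP.
(* [F0] excludes k = 0, so m - 1 is still in the range searched and minimality applies to it. *)
case: k kP kmin => [|k] kP kmin; first by move: F0; rewrite ltNge -[X in F X]addr0 kP.
set m := - N%:Z - 1 + k.+1%:Z in kP.
have Fk : F (m - 1) < 2^-1.
  rewrite ltNge; apply/negP; rewrite (_ : m - 1 = - N%:Z - 1 + k%:Z); last by rewrite /m; lia.
  by move=> /kmin; rewrite ltnn.
have Fm : F m <= F (m - 1) + th.
  suff : F m <= F (m - 1) + p m by have := pth m; lra.
  apply: (le_has_sum (FE _) (has_sumD (FE (m - 1)) (has_sum_single m (p0 m)))) => x.
  case: ifPn => xm; last by rewrite addr_ge0//; case: ifP.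
  case: ifPn => xm1; first by rewrite lerDl; case: ifP.
  case: eqP => [->|]; first by rewrite add0r.
  lia.
have [Fm_le|Fm_gt] := leP (F m) ((1 + th) / 2).
  by exists m, (F m); split=> //; lra.
by exists (m - 1), (F (m - 1)); split=> //; lra.
Qed.

End IntPmf.

(** * Bounds on twice the entropy gap, in nats *)

Section EntropyGap.
Context {R : realType}.
Implicit Types p q : int -> R.

Definition entropic_triple p q (hp hq hr : R) : Prop :=
  [/\ has_sum p 1, has_sum q 1,
      has_sum (fun i => - (p i * ln (p i))) hp,
      has_sum (fun i => - (q i * ln (q i))) hq &
      has_sum (fun i => - (convolution p q i * ln (convolution p q i))) hr].

Lemma entropic_tripleC p q hp hq hr :
  entropic_triple p q hp hq hr -> entropic_triple q p hq hp hr.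
Proof. by move=> [p1 q1 hhp hhq hhr]; split=> //; rewrite convolutionC. Qed.

Lemma mulN_ln_le (x : R) : 0 <= x -> - (x * ln x) <= 1 - x.
Proof. by move=> x0; have := @gibbs R x 1 x0 ler01 (fun=> ltr01); rewrite ln1; lra. Qed.

(** With v the square root of x, - x ln x = 2 v (- v ln v) <= 2 v (1 - v). *)
Lemma mulN_ln_le_root (x s : R) : 0 <= s -> 0 <= x <= s ^+ 2 -> - (x * ln x) <= 2 * s.
Proof.
move=> s0 /andP[x0 xs]; pose v := Num.sqrt x.
have v0 : 0 <= v := sqrtr_ge0 x.
have vs : v <= s by rewrite -(ler_pXn2r (n := 2))// ?nnegrE// sqr_sqrtr.
have -> : - (x * ln x) = 2 * v * - (v * ln v).
  rewrite -(sqr_sqrtr x0) -/v; have := v0; rewrite le_eqVlt => /predU1P[<-|vgt0].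
    by rewrite expr0n/= !(mul0r, mulr0, oppr0).
  by rewrite lnXn//; ring.
have := mulN_ln_le v0; nra.
Qed.

Lemma entropies_le_convolution p q hp hq hr : entropic_triple p q hp hq hr ->
  hp <= hr /\ hq <= hr.
Proof.
move=> [p1 q1 hhp hhq hhr].
by split; [apply: entropy_convolution_gel hhp hhr|apply: entropy_convolution_ger hhq hhr].
Qed.

(** The atom bound on hr - hp, added to hq <= hr. *)
Lemma entropy_gap_atom p q hp hq hr x : entropic_triple p q hp hq hr ->
  p x * hq + p x * ln (p x) + (1 - p x) * ln (1 - p x) <= 2 * hr - hp - hq.
Proof.
move=> pq; have [_ hqr] := entropies_le_convolution pq; case: pq => p1 q1 hhp hhq hhr.
have := entropy_convolution_atom x p1 q1 hhp hhq hhr; lra.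
Qed.

(** Balanced cuts make A B and (1 - A) (1 - B) at least ((1 - th) / 2)^2, hence also their average
    with weights 1 - C and C. *)
Lemma entropy_gap_flat p q hp hq hr th k K : entropic_triple p q hp hq hr ->
  th <= 1 -> (forall x, p x <= th) -> (forall x, q x <= th) ->
  0 <= k -> 0 <= K -> bernoulli_mgf_le k K ->
  k * (1 - th) ^+ 2 - 2 * K <= 2 * hr - hp - hq.
Proof.
move=> [p1 q1 hhp hhq hhr] th1 pth qth k0 K0 mgf.
have [m [A [pA /andP[A0 A1]]]] := balanced_cut p1 pth.
have [n [B [qB /andP[B0 B1]]]] := balanced_cut q1 qth.
have r1 := convolution_has_sum1 p1 q1.
have [C rC] : exists C, lower_mass (convolution p q) (m + n) C.
  by apply: (has_sum_dominated _ r1) => x; case: ifP; rewrite ?lexx (proj1 r1).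
have /andP[C0 C1] := lower_mass_bound r1 rC.
apply: le_trans (entropy_convolution_cut p1 q1 hhp hhq hhr pA qB rC k0 K0 mgf).
rewrite lerD2r (mulrC 4) -(mulrA k 4) ler_wpM2l//.
set u := (1 - th) / 2; have u0 : 0 <= u by rewrite /u; lra.
have -> : (1 - th) ^+ 2 = 4 * (u * u) by rewrite /u; field.
rewrite ler_pM2l//.
have AB : u * u <= A * B by rewrite ler_pM.
have AB' : u * u <= (1 - A) * (1 - B) by rewrite ler_pM// /u; lra.
have C1' : 0 <= 1 - C by rewrite subr_ge0.
have := ler_wpM2r C1' AB; have := ler_wpM2r C0 AB'; lra.
Qed.

Lemma atom_dichotomy p (th : R) : (exists x, th < p x) \/ (forall x, p x <= th).
Proof.
have [|/forallNP h] := pselect (exists x, th < p x); first by left.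
by right=> x; rewrite leNgt; apply/negP/h.
Qed.

(** An atom above [e] gives at least 5/4 - 1, as a binary entropy is at most 1 nat. Otherwise k =
    1/2 and K = 1/8 give (1 - e)^2 / 2 - 1/4 >= 1/4 - e. *)
Lemma entropy_gap_large p q hp hq hr e : entropic_triple p q hp hq hr ->
  0 < e -> e <= 1 -> 5 / (4 * e) <= hp -> 5 / (4 * e) <= hq ->
  4^-1 - e <= 2 * hr - hp - hq.
Proof.
move=> pq e0 e1.
rewrite !ler_pdivrMr ?mulr_gt0// => hpe hqe.
have atom q' hq' hp' hr' p' x : entropic_triple p' q' hp' hq' hr' ->
    5 <= hq' * (4 * e) -> e < p' x -> 4^-1 <= 2 * hr' - hp' - hq'.
  move=> pq' hqe' ex; have := entropy_gap_atom x pq'.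
  case: pq' => p1 _ _ _ _; have p0 := proj1 p1 x.
  have p_le1 : 0 <= 1 - p' x by rewrite subr_ge0 has_sum_le1.
  have := mulN_ln_le p0; have := mulN_ln_le p_le1.
  have hq0 : 0 < hq' by nra.
  have : e * hq' <= p' x * hq' by rewrite ler_pM2r// ltW.
  lra.
have [[x ex]|pe] := atom_dichotomy p e.
  by have := atom _ _ _ _ _ _ pq hqe ex; lra.
have [[x ex]|qe] := atom_dichotomy q e.
  by have := atom _ _ _ _ _ _ (entropic_tripleC pq) hpe ex; lra.
have h0 : 0 <= 2^-1 :> R by rewrite invr_ge0.
have h1 : 0 <= 8^-1 :> R by rewrite invr_ge0.
by have := entropy_gap_flat pq e1 pe qe h0 h1 bernoulli_mgf_le_half; nra.
Qed.

(** If one entropy is below c / 2, the other is at least c and so is [hr]. Otherwise either some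
    atom is close to 1 or all atoms stay away from 1. *)
Lemma entropy_gap_pos (c : R) : 0 < c -> exists2 dlt, 0 < dlt &
  forall p q hp hq hr, entropic_triple p q hp hq hr -> c <= hp \/ c <= hq ->
    dlt <= 2 * hr - hp - hq.
Proof.
(* An atom above 1 - s^2 exceeds 3/4 and has binary entropy at most 5 s / 2, so it leaves 3 c / 8 -
   5 s / 2 >= c / 8. *)
move=> c0; pose s := Num.min 2^-1 (c / 12).
have s0 : 0 < s by rewrite lt_min invr_gt0 divr_gt0// ltr0n.
have s1 : s <= 2^-1 by rewrite ge_min lexx.
have s2 : s <= c / 12 by rewrite ge_min lexx orbT.
exists (Num.min (c / 8) (s ^+ 8 / 16)) => [|p q hp hq hr pq hc].
  by rewrite lt_min !divr_gt0// exprn_gt0.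
have [hpr hqr] := entropies_le_convolution pq.
have [hpc|hpc] := ltP hp (c / 2).
  by rewrite ge_min; apply/orP; left; case: hc => hc; lra.
have [hqc|hqc] := ltP hq (c / 2).
  by rewrite ge_min; apply/orP; left; case: hc => hc; lra.
have atom q' hq' hp' hr' p' x : entropic_triple p' q' hp' hq' hr' ->
    c / 2 <= hq' -> 1 - s ^+ 2 < p' x -> c / 8 <= 2 * hr' - hp' - hq'.
  move=> pq' hqc' sx; have := entropy_gap_atom x pq'.
  case: pq' => p1 _ _ _ _; have p0 := proj1 p1 x.
  have p_le1 : 0 <= 1 - p' x by rewrite subr_ge0 has_sum_le1.
  have p_s : 0 <= 1 - p' x <= s ^+ 2 by rewrite p_le1/=; lra.
  have := mulN_ln_le p0; have := mulN_ln_le_root (ltW s0) p_s.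
  have ss : s ^+ 2 <= s * 2^-1 by rewrite expr2 ler_pM2l.
  have : 3 / 4 * (c / 2) <= p' x * hq' by rewrite ler_pM//; lra.
  lra.
have [[x ex]|pe] := atom_dichotomy p (1 - s ^+ 2).
  by rewrite ge_min (atom _ _ _ _ _ _ pq hqc ex).
have [[x ex]|qe] := atom_dichotomy q (1 - s ^+ 2).
  by rewrite ge_min (le_trans (atom _ _ _ _ _ _ (entropic_tripleC pq) hpc ex))//; lra.
rewrite ge_min; apply/orP; right.
have th1 : 1 - s ^+ 2 <= 1 by rewrite gerBl sqr_ge0.
(* Maximises k s^4 - 4 k^2, the flat bound for K = 2 k^2 and th = 1 - s^2; the maximum is s^8 /
   16. *)
pose k := s ^+ 4 / 8.
have k0 : 0 <= k by rewrite divr_ge0// exprn_ge0// ltW.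
have k1 : 0 <= k <= 4^-1.
  rewrite k0/= /k; suff : s ^+ 4 <= 1 by lra.
  by rewrite exprn_ile1// ltW//; lra.
have K0 : 0 <= 2 * k ^+ 2 by rewrite mulr_ge0// sqr_ge0.
have := entropy_gap_flat pq th1 pe qe k0 K0 (bernoulli_mgf_le_small k1).
by apply: le_trans; rewrite /k; lra.
Qed.

End EntropyGap.

(** * The universal gap function, in bits *)

Section UniversalGap.
Context {R : realType}.

(** Bounding the entropies from below instead of fixing them makes the sets shrink as [c] and [d]
    grow, so their infimum is increasing. The factors ln 2 convert between bits and nats. *)
Definition entropy_gaps (c d : R) : set R :=
  [set x | exists p q hp hq hr, [/\ entropic_triple p q hp hq hr,
    c * ln 2 <= hp, d * ln 2 <= hq & x = (hr - (hp + hq) / 2) / ln 2]].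

Definition gap_limit : R := 8^-1 * log2 (expR 1).

(* Adjoining [gap_limit] keeps the infimum away from the empty set, whose
   [inf] would be the junk value 0. *)
Definition gap_inf (c d : R) : R := inf (gap_limit |` entropy_gaps c d).

(** The term c + d forces the value 0 at the origin; it is increasing, positive elsewhere on the
    quadrant, and eventually above the limit. *)
Definition universal_gap (c d : R) : R := Num.min (c + d) (gap_inf c d).

Lemma ln2_gt0 : 0 < ln 2 :> R.
Proof. by rewrite ln_gt0// ltr1n. Qed.

Lemma gap_limitE : gap_limit = 8^-1 / ln 2.
Proof. by rewrite /gap_limit /log2 expRK mul1r. Qed.

Lemma gap_inf_nonempty c d : gap_limit |` entropy_gaps c d !=set0.
Proof. by exists gap_limit; left. Qed.

Lemma gap_inf_ge (c d x : R) : x <= gap_limit ->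
  (forall p q hp hq hr, entropic_triple p q hp hq hr ->
     c * ln 2 <= hp -> d * ln 2 <= hq -> x * (2 * ln 2) <= 2 * hr - hp - hq) ->
  x <= gap_inf c d.
Proof.
move=> xl xg; apply: lb_le_inf; first exact: gap_inf_nonempty.
move=> _ [-> //|[p [q [hp [hq [hr [pq hpc hqd ->]]]]]]].
by rewrite ler_pdivlMr ?ln2_gt0//; have := xg _ _ _ _ _ pq hpc hqd; lra.
Qed.

Lemma gap_inf_lb c d : has_lbound (gap_limit |` entropy_gaps c d).
Proof.
exists 0 => _ [->|[p [q [hp [hq [hr [pq _ _ ->]]]]]]].
  by rewrite gap_limitE divr_ge0// ltW// ln2_gt0.
rewrite divr_ge0 ?(ltW ln2_gt0)//; have [] := entropies_le_convolution pq; lra.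
Qed.

Lemma gap_inf_ge0 c d : 0 <= gap_inf c d.
Proof.
apply: gap_inf_ge => [|p q hp hq hr pq _ _].
  by rewrite gap_limitE divr_ge0// ltW// ln2_gt0.
by rewrite mul0r; have [] := entropies_le_convolution pq; lra.
Qed.

Lemma gap_inf_le_limit c d : gap_inf c d <= gap_limit.
Proof. by apply: ge_inf; [exact: gap_inf_lb|left]. Qed.

Lemma le_gap_inf c c' d d' : c <= c' -> d <= d' -> gap_inf c d <= gap_inf c' d'.
Proof.
move=> cc dd; apply: lb_le_inf; first exact: gap_inf_nonempty.
move=> x xE; apply: (ge_inf (gap_inf_lb c d)).
case: xE => [|[p [q [hp [hq [hr [pq hpc hqd ->]]]]]]]; first by left.
right; exists p, q, hp, hq, hr; split=> //.
  by apply: le_trans hpc; rewrite ler_pM2r// ln2_gt0.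
by apply: le_trans hqd; rewrite ler_pM2r// ln2_gt0.
Qed.

Lemma gap_inf_gt0 c d : 0 <= c -> 0 <= d -> 0 < c + d -> 0 < gap_inf c d.
Proof.
move=> c0 d0 cd; have l2 := ln2_gt0.
(* The larger of [c] and [d] is at least their mean. *)
have [|dlt dlt0 gap] := @entropy_gap_pos R ((c + d) / 2 * ln 2).
  by rewrite mulr_gt0// divr_gt0.
apply: (@lt_le_trans _ _ (Num.min gap_limit (dlt / (2 * ln 2)))).
  by rewrite lt_min gap_limitE !divr_gt0// ?invr_gt0// mulr_gt0.
apply: gap_inf_ge => [|p q hp hq hr pq hpc hqd]; first by rewrite ge_min lexx.
apply: (@le_trans _ _ dlt).
  rewrite -ler_pdivlMr ?mulr_gt0//; by rewrite ge_min lexx orbT.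
apply: (gap _ _ _ _ _ pq); have [cd_le|dc_le] := leP d c; [left|right].
  by apply: le_trans hpc; rewrite ler_pM2r//; lra.
by apply: le_trans hqd; rewrite ler_pM2r//; lra.
Qed.

Lemma gap_inf_near_limit e : 0 < e -> exists M, forall c d, M <= c -> M <= d ->
  gap_limit - e <= gap_inf c d.
Proof.
move=> e0; have l2 := ln2_gt0.
(* An error [e] on the gap in bits is 2 e ln 2 on twice the gap in nats. *)
pose f := Num.min 1 (e * (2 * ln 2)).
have f0 : 0 < f by rewrite lt_min ltr01 !mulr_gt0.
have f1 : f <= 1 by rewrite ge_min lexx.
have fe : f <= e * (2 * ln 2) by rewrite ge_min lexx orbT.
exists (5 / (4 * f) / ln 2) => c d; rewrite !(ler_pdivrMr _ _ l2) => Mc Md.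
apply: gap_inf_ge => [|p q hp hq hr pq hpc hqd]; first by rewrite gerBl ltW.
have := entropy_gap_large pq f0 f1 (le_trans Mc hpc) (le_trans Md hqd).
apply: le_trans; rewrite gap_limitE.
have -> : (8^-1 / ln 2 - e) * (2 * ln 2) = 4^-1 - e * (2 * ln 2).
  by field; rewrite gt_eqF.
lra.
Qed.

Lemma log2_has_sum (p : int -> R) h :
  has_sum (fun i => - (p i * log2 (p i))) h ->
  has_sum (fun i => - (p i * ln (p i))) (h * ln 2).
Proof.
move=> ph; have l2 := ln2_gt0; rewrite mulrC.
apply: eq_has_sum (has_sumZ (ltW l2) ph) => i.
by rewrite /log2 mulrN; congr (- _); field; rewrite gt_eqF.
Qed.

Lemma shannon_entropy_has_sum (p : int -> R) : has_sum p 1 ->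
  shannon_entropy p \is a fin_num ->
  has_sum (fun i => - (p i * log2 (p i))) (fine (shannon_entropy p)).
Proof.
move=> p1 pfin; split=> [i|]; last by rewrite fineK.
rewrite -mulrN mulr_ge0 ?(proj1 p1)// oppr_ge0 /log2.
by rewrite pmulr_lle0 ?invr_gt0 ?ln2_gt0// ln_le0// has_sum_le1.
Qed.

Lemma shannon_entropy_ge0 (p : int -> R) : has_sum p 1 ->
  (0 <= shannon_entropy p)%E.
Proof.
move=> p1; apply: esum_ge0 => i _; rewrite lee_fin -mulrN mulr_ge0 ?(proj1 p1)//.
rewrite oppr_ge0 /log2.
by rewrite pmulr_lle0 ?invr_gt0 ?ln2_gt0// ln_le0// has_sum_le1.
Qed.

Lemma universal_gap_le (p q : int -> R) : has_sum p 1 -> has_sum q 1 ->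
  shannon_entropy p \is a fin_num -> shannon_entropy q \is a fin_num ->
  (shannon_entropy (convolution p q)
     - (shannon_entropy p + shannon_entropy q) * (2^-1)%:E
   >= (universal_gap (fine (shannon_entropy p)) (fine (shannon_entropy q)))%:E)%E.
Proof.
move=> p1 q1 pfin qfin; have r1 := convolution_has_sum1 p1 q1.
have ph := shannon_entropy_has_sum p1 pfin.
have qh := shannon_entropy_has_sum q1 qfin.
rewrite -[in leRHS](fineK pfin) -[in leRHS](fineK qfin).
have [rfin|] := boolP (shannon_entropy (convolution p q) \is a fin_num); last first.
  (* If the sum has infinite entropy, the left-hand side is infinite. *)
  rewrite ge0_fin_numE ?shannon_entropy_ge0// -leNgt leye_eq => /eqP ->.
  by rewrite -EFinD -EFinM leey.
have rh := shannon_entropy_has_sum r1 rfin.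
rewrite -(fineK rfin) /= lee_fin ge_min; apply/orP; right.
apply: (ge_inf (gap_inf_lb _ _)); right.
exists p, q, (fine (shannon_entropy p) * ln 2), (fine (shannon_entropy q) * ln 2),
  (fine (shannon_entropy (convolution p q)) * ln 2); split => //.
  by split=> //; exact: log2_has_sum.
by have l2 := ln2_gt0; field; rewrite gt_eqF.
Qed.

End UniversalGap.

Theorem theorem2 (R : realType) :
  exists g : R -> R -> R,
    [/\ (forall (d : measure_display) (T : measurableType d)
          (P : probability T R) (X X' : {RV P >-> int}),
          independent_RVs X X' ->
          let p1 := int_pmf X in
          let p2 := int_pmf X' in
          shannon_entropy p1 \is a fin_num ->
          shannon_entropy p2 \is a fin_num ->
          (shannon_entropy (convolution p1 p2)
             - (shannon_entropy p1 + shannon_entropy p2) * (2^-1)%:E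
           >= (g (fine (shannon_entropy p1)) (fine (shannon_entropy p2)))%:E)%E),
        (forall c d : R, 0 <= c -> 0 <= d -> 0 <= g c d),
        doubly_increasing g,
        (g x.1 x.2 @[x --> (+oo, +oo)] --> 8^-1 * log2 (expR 1)) &
        (forall c d : R, 0 <= c -> 0 <= d ->
           (g c d = 0 <-> c = 0 /\ d = 0))].
Proof.
exists universal_gap; split.
- move=> d T P X X' _ p1 p2.
  by apply: universal_gap_le; exact: int_pmf_has_sum1.
- by move=> c d c0 d0; rewrite le_min gap_inf_ge0 addr_ge0.
- split=> [c c' d _ _ cc|c d d' _ _ dd]; rewrite le_min !ge_min.
    by rewrite lerD2r cc /= le_gap_inf// orbT.
  by rewrite lerD2l dd /= le_gap_inf// orbT.
- apply/cvgrPdist_le => e e0; have [M gM] := gap_inf_near_limit e0.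
  (* Arguments above [gap_limit] keep c + d above it too, so the cap does not pull the minimum below
     the limit. *)
  pose N := Num.max M gap_limit.
  exists ([set x | N < x], [set x | N < x]) => /=.
    by split; exists N; split=> //; exact: num_real.
  move=> [c d] /= [/ltW Nc /ltW Nd].
  have [Mc Lc] : M <= c /\ gap_limit <= c by move: Nc; rewrite ge_max => /andP.
  have [Md Ld] : M <= d /\ gap_limit <= d by move: Nd; rewrite ge_max => /andP.
  have L0 : 0 <= gap_limit :> R := le_trans (gap_inf_ge0 c d) (gap_inf_le_limit c d).
  have le_L : universal_gap c d <= gap_limit by rewrite ge_min gap_inf_le_limit orbT.
  have ge_L : gap_limit - e <= universal_gap c d.
    by rewrite le_min (gM _ _ Mc Md) andbT; lra.
  by rewrite ger0_norm -/gap_limit; lra.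
- move=> c d c0 d0; split=> [g0|[-> ->]]; last first.
    by rewrite /universal_gap addr0; apply/min_idPl; exact: gap_inf_ge0.
  have : ~~ (0 < c + d).
    apply/negP => cd; have : 0 < universal_gap c d by rewrite lt_min cd gap_inf_gt0.
    by rewrite g0 ltxx.
  by rewrite -leNgt => cd; split; lra.
Qed.
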